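(* Let $N\ge 2$ and let $r,s$ be coprime positive integers with $N\le r$. Let $V\subset S_r$ be a general linear subspace of dimension $N+1$. Then every nonzero linear subspace $W\subset S_{s-1}$ satisfies $\eta(V\cdot W)\ge\eta(W)$ if and only if $s/r\in\Phi_N$.
   Context: Over $\mathbb{C}$, $S_a=H^0(\mathcal{O}_{\mathbb{P}^1}(a))$ denotes the space of homogeneous polynomials of degree $a$ in two variables $u,v$ (so $\dim S_a=a+1$; $S_{-1}=0$). For subspaces $V,W$, $V\cdot W$ denotes the linear span of all products $fg$, $f\in V$, $g\in W$. For a subspace $W\subset S_{t-1}$ put $\eta(W)=\dim W/t$ (so for $W\subset S_{s-1}$, $\eta(W)=\dim W/s$, and $V\cdot W\subset S_{r+s-1}$ has $\eta(V\cdot W)=\dim(V\cdot W)/(r+s)$). ''General'' means lying in a nonempty Zariski-open subset of the Grassmannian. Define $\rho_N(x)=\dfrac{1}{N-1+\frac{1}{1+x}}$, $\rho_N^0=\mathrm{id}$, $\rho_N^{i+1}=\rho_N\circ\rho_N^i$, $\phi_N=\lim_{i\to\infty}\rho_N^i(0)$, and $\Phi_N=\{\alpha\in\mathbb{Q}:\alpha>\phi_N\}\cup\{\rho_N^i(0):i\ge 0\}$. *)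

(* Defs.v *)
From HB Require Import structures.
From mathcomp Require Import all_boot all_order all_algebra.
From Stdlib Require Reals.

Set Implicit Arguments.
Unset Strict Implicit.
Unset Printing Implicit Defensive.

Import Order.TTheory GRing.Theory Num.Theory.
Local Open Scope ring_scope.

(* S_a = H^0(O_{P^1}(a)): binary forms of degree a in u,v, represented by  *)
(* their coefficient vectors in F^(a+1): entry i <-> coefficient of        *)
(* u^i v^(a-i).  Multiplication of forms is convolution of coefficients,   *)
(* computed here through rVpoly / poly_rV.                                  *)
Definition S (F : fieldType) (a : nat) := 'rV[F]_a.+1.

Definition hmul (F : fieldType) (a b : nat) (f : 'rV[F]_a.+1) (g : 'rV[F]_b.+1)
  : 'rV[F]_(a + b).+1 := poly_rV (rVpoly f * rVpoly g).

Definition prodS (F : fieldType) (a b : nat)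
  (V : {vspace 'rV[F]_a.+1}) (W : {vspace 'rV[F]_b.+1}) : {vspace 'rV[F]_(a + b).+1} :=
  <<allpairs (@hmul F a b) (vbasis V) (vbasis W)>>%VS.

(* eta(W) = dim W / t for W a subspace of S_{t-1} *)
Definition etaS (F : fieldType) (n t : nat) (W : {vspace 'rV[F]_n}) : rat :=
  (\dim W)%:R / t%:R.

Inductive pexpr (F : Type) (I : Type) : Type :=
| PConst of F
| PVar of I
| PAdd of pexpr F I & pexpr F I
| PMul of pexpr F I & pexpr F I.

Fixpoint peval (F : nzRingType) (I : Type) (x : I -> F) (e : pexpr F I) : F :=
  match e with
  | PConst c => c
  | PVar i => x i
  | PAdd e1 e2 => peval x e1 + peval x e2
  | PMul e1 e2 => peval x e1 * peval x e2
  end.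

Definition zariski_open (F : nzRingType) (I : Type) (U : (I -> F) -> Prop) : Prop :=
  exists ps : seq (pexpr F I), forall x, U x <-> has (fun p => peval x p != 0) ps.

Definition mx_of (F : nzRingType) (k n : nat) (x : 'I_k * 'I_n -> F) : 'M[F]_(k, n) :=
  \matrix_(i, j) x (i, j).

Definition rowsp (F : fieldType) (k n : nat) (A : 'M[F]_(k, n)) : {vspace 'rV[F]_n} :=
  <<[seq row i A | i <- enum 'I_k]>>%VS.

(* "A general k-dimensional subspace V of F^n satisfies P": P holds on a    *)
(* nonempty Zariski-open subset of the Grassmannian G(k,n).  Equivalently   *)
(* (the quotient map from full-rank k x n matrices to G(k,n) is open and     *)
(* surjective) there is a nonempty Zariski-open set of k x n matrices, all  *)
(* of rank k, whose row spaces satisfy P.                                   *)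
Definition general_subspace (F : fieldType) (k n : nat)
  (P : {vspace 'rV[F]_n} -> Prop) : Prop :=
  exists U : ('I_k * 'I_n -> F) -> Prop,
    [/\ zariski_open U, (exists x, U x) &
        forall x, U x -> \rank (mx_of x) = k /\ P (rowsp (mx_of x))].

Definition rho (N : nat) (x : Reals.Rdefinitions.R) : Reals.Rdefinitions.R :=
  Reals.Rdefinitions.Rdiv Reals.Rdefinitions.R1
    (Reals.Rdefinitions.Rplus
       (Reals.Rdefinitions.Rminus (Reals.Raxioms.INR N) Reals.Rdefinitions.R1)
       (Reals.Rdefinitions.Rdiv Reals.Rdefinitions.R1
          (Reals.Rdefinitions.Rplus Reals.Rdefinitions.R1 x))).

Definition rho_iter (N i : nat) : Reals.Rdefinitions.R :=
  Nat.iter i (rho N) Reals.Rdefinitions.R0.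

Definition in_Phi (N : nat) (a : Reals.Rdefinitions.R) : Prop :=
  (exists phi, Reals.Rseries.Un_cv (rho_iter N) phi /\ Reals.Rdefinitions.Rlt phi a)
  \/ (exists i, a = rho_iter N i).

Definition ratioR (s r : nat) : Reals.Rdefinitions.R :=
  Reals.Rdefinitions.Rdiv (Reals.Raxioms.INR s) (Reals.Raxioms.INR r).

(* Main.v *)
(* Write t = r + s and d = r^2 - (N-1) s t.  For coprime r, s the condition
   s/r \in Phi_N means d <= 1.

   If d >= 2, then for any V the pairs (alpha, beta) of endomorphisms of S_{s-1}
   and S_{t-1} intertwining all multiplications by elements of V form a space of
   dimension at least s^2 + t^2 - (N+1) s t = d >= 2, so one of them is not
   scalar.  Subtracting an eigenvalue of alpha, the kernel and the image of alpha
   cannot both satisfy the inequality, since s and t are coprime.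

   If d <= 1, it suffices to find one V = <f_0, ..., f_N> and scalar matrices B_i
   such that A = sum_i f_i B_i, with q/p = s/t, is injective from S_{s-1}^p to
   S_{t-1}^q: this is an open condition on the f_i, and restricting A to W^p gives
   p dim W <= q dim VW.  Such pairs (f, B) are constructed by induction.
   - If r <= s, take f = (1, z^rho, 1, ..., 1, z^r) with rho = s mod r and B generic
     homogeneous for a Z/s-grading; A splits into blocks whose nonzero entries are
     independent, so a perfect matching makes them invertible.
   - (r, s) gives (r + s, s) with one more form: add z^(r+s) to f.
   - (r, s) gives (N r + (N-1) s, r + s), i.e. s/r becomes rho_N(s/r): replace B by
     the kernel of (B_i)_i and f by a curve g with <g, f> = 0 such that the
     polynomial vectors of degree < t orthogonal to g are the multiples of f. *)

Require Import Defs.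
From HB Require Import structures.
From mathcomp Require Import all_boot all_order all_algebra.
From mathcomp Require Import perm zify ring.
From Stdlib Require Reals Lra.
Set Implicit Arguments.
Unset Strict Implicit.
Unset Printing Implicit Defensive.
Import Order.TTheory GRing.Theory Num.Theory.

(** * Arithmetic of the form [d = r^2 - (N-1) s (r+s)] *)

Lemma reflection_descent N r s : (0 < N)%N -> (N.-1 * s < r)%N ->
  (r ^ 2 <= N.-1 * (s * (r + s)) + 1)%N -> (0 < s)%N ->
  exists r0 s0, [/\ (0 < r0)%N, (r0 + s0 = s)%N, (r = N * r0 + N.-1 * s0)%N
    & (r0 ^ 2 + N.-1 * (s * (r + s)) = r ^ 2 + N.-1 * (s0 * s))%N].
Proof.
case: N => // M _ /= lt_r; rewrite -mulnn => q_le1 s_gt0.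
have le_rN : (r <= M.+1 * s)%N.
  rewrite leqNgt; apply/negP => ltN.
  have : ((r + s) * M.+1 * s + (r + s) <= (r + s) * r)%N.
    by rewrite -mulnA -mulnSr leq_mul2l ltN orbT.
  by nia.
(* [r0 = r - (N-1) s] and [s0 = s - r0] invert the map [(r, s) -> (N r + (N-1) s, r + s)]. The last
   claim is the invariance of [d], written without subtraction. *)
have [r0 rE] : exists r0, r = (M * s + r0)%N by exists (r - M * s)%N; rewrite subnKC // ltnW.
have [s0 sE] : exists s0, s = (r0 + s0)%N.
  by exists (s - r0)%N; rewrite subnKC //; move: le_rN; rewrite rE mulSn addnC leq_add2r.
exists r0, s0; split=> //; first by move: lt_r; rewrite rE -[X in (X < _)%N]addn0 ltn_add2l.
  by rewrite rE sE; ring.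
by rewrite rE sE -!mulnn; ring.
Qed.

Lemma reflect_real_root n r s :
  (r ^ 2 = n * (s * (r + s)) + 1)%N ->
  ((n.+1 * r + n * s) ^ 2 = n * ((r + s) * (n.+1 * r + n * s + (r + s))) + 1)%N.
Proof.
rewrite -!mulnn => q1.
transitivity (r * r + (n * (r + s) * (n * (r + s)) + 2 * (n * (r + s) * r)))%N; first by ring.
by rewrite q1; ring.
Qed.

(** The form is quadratic, so its value at [(r, s)] is [(r/R)^2 <= 1] times its value 1 at
    [(R, T)]. *)
Lemma proportional_root n r s R T : (0 < R)%N -> (r <= R)%N -> (s * R = T * r)%N ->
  (R ^ 2 = n * (T * (R + T)) + 1)%N -> (r ^ 2 <= n * (s * (r + s)) + 1)%N.
Proof.
move=> R_gt0 le_rR cross q1.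
have key : (R ^ 2 * r ^ 2 = R ^ 2 * (n * (s * (r + s))) + r ^ 2)%N.
  rewrite {1}q1 mulnDl mul1n; congr (_ + _)%N.
  have -> : (R ^ 2 * (n * (s * (r + s))) = n * ((s * R) * (R * r + s * R)))%N by ring.
  by rewrite cross; ring.
have R2 : (0 < R ^ 2)%N by rewrite expn_gt0 R_gt0.
by rewrite -(leq_pmul2l R2) key [leqRHS]mulnDr leq_add2l muln1 leq_exp2r.
Qed.

(** * A transport plan for the case [r <= s] *)

Section Transport.
Local Open Scope nat_scope.
Variables r s : nat.
Hypotheses (r_gt0 : 0 < r) (le_rs : r <= s).

(* A transport plan along the edges b -> b, b -> b + (s mod r), b -> b + r, carrying
   low_flow b, mid_flow b and high_flow b: each b < s sends r + s units and each
   c < r + s receives s units.  Along a residue class mod r the sources have a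
   surplus or a deficit; the middle edges move it to the class b + (s mod r). *)
Definition mid_flow b := r - b.

Definition low_flow b :=
  if s <= b then 0 else
  if b %% r < s %% r then (if b < r then s else s - s %% r + r - (b - b %% r))
  else (if b < r then s - s %% r - r + b else s - s %% r - (b - b %% r)).

Definition high_flow b := r + s - (low_flow b + mid_flow b).

Lemma modn_split b : exists i, b = i * r + b %% r /\ b %% r < r.
Proof. by exists (b %/ r); rewrite -divn_eq ltn_mod. Qed.

(** These cases are all that the flow bounds use of the multiples [i * r] and [k * r]; once the
    multiples are replaced by variables, the goals are linear. *)
Lemma multiple_cases i k : 0 < r ->
  [\/ i * r + r <= k * r, i * r = k * r, i * r = k * r + r | k * r + r + r <= i * r].
Proof.
move=> r0; rewrite -!mulSnr; have [lt|lt|->] := ltngtP i k.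
- by constructor 1; rewrite leq_mul2r lt orbT.
- have [lt'|le] := ltnP k.+1 i; first by constructor 4; rewrite leq_mul2r lt' orbT.
  by constructor 3; congr (_ * _); apply/eqP; rewrite eqn_leq le lt.
- by constructor 2.
Qed.

(** Makes the truncated subtraction in [high_flow] exact: the three flows out of [b] add up to
    [r + s]. *)
Lemma flow_row b : b < s -> low_flow b + mid_flow b <= r + s.
Proof.
move=> ltbs; rewrite /low_flow /mid_flow [s <= b]leqNgt ltbs /=.
have [i [bE ltb]] := modn_split b; have [k [sE lts]] := modn_split s.
have i_k := multiple_cases i k r_gt0.
have i_0 : [\/ i * r = 0, i * r = r | r + r <= i * r].
  by have := multiple_cases i 0 r_gt0; rewrite mul0n add0n => -[?|?|?|?];
    [lia|constructor 1|constructor 2|constructor 3].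
set b0 := b %% r in bE ltb *; set s0 := s %% r in sE lts *.
set m := i * r in bE i_k i_0; set K := k * r in sE i_k.
clearbody b0 s0 m K.
by repeat (case: ifP => ?; try (exfalso; lia)); case: i_k => ?; case: i_0 => ?; lia.
Qed.

(** The terms arrive along the edges from [c], [c - s %% r] and [c - r]. The bound leaves room for
    distinct places below [s]. *)
Lemma flow_col c : c < r + s ->
  low_flow c + (if s %% r <= c then mid_flow (c - s %% r) else 0)
  + (if r <= c then high_flow (c - r) else 0) <= s.
Proof.
move=> ltct.
have mod_r : r <= c -> (c - r) %% r = c %% r.
  by move=> le_rc; rewrite -{2}(subnK le_rc) modnDr.
rewrite /high_flow /low_flow /mid_flow.
have [i [cE ltb]] := modn_split c; have [k [sE lts]] := modn_split s.
have i_k := multiple_cases i k r_gt0.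
have i_0 : [\/ i * r = 0, i * r = r | r + r <= i * r].
  by have := multiple_cases i 0 r_gt0; rewrite mul0n add0n => -[?|?|?|?];
    [lia|constructor 1|constructor 2|constructor 3].
case: (leqP r c) mod_r => [le_rc /(_ isT) ->|lt_cr _].
  set b0 := c %% r in cE ltb *; set s0 := s %% r in sE lts *.
  set m := i * r in cE i_k i_0; set K := k * r in sE i_k.
  clearbody b0 s0 m K.
  by repeat (case: ifP => ?; try (exfalso; lia)); case: i_k => ?; case: i_0 => ?; lia.
set b0 := c %% r in cE ltb *; set s0 := s %% r in sE lts *.
set m := i * r in cE i_k i_0; set K := k * r in sE i_k.
clearbody b0 s0 m K.
by repeat (case: ifP => ?; try (exfalso; lia)); case: i_k => ?; case: i_0 => ?; lia.
Qed.
End Transport.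

Local Open Scope ring_scope.

(** * Injective matrices indexed by finite types *)

Section InjectiveKernels.
Variable F : fieldType.

(** Row vectors act from the left: [A] indexes the unknowns and [C] the equations. *)
Definition inj_kernel (A C : finType) (M : A -> C -> F) : Prop :=
  forall u : A -> F, (forall c, \sum_a u a * M a c = 0) -> forall a, u a = 0.

Definition kernel_mx (A C : finType) (M : A -> C -> F) : 'M[F]_(#|A|, #|C|) :=
  \matrix_(i, j) M (enum_val i) (enum_val j).

Lemma mul_kernel_mx (A C : finType) (M : A -> C -> F) (v : 'rV_#|A|) (c : C) :
  (v *m kernel_mx M) 0 (enum_rank c) = \sum_a v 0 (enum_rank a) * M a c.
Proof.
rewrite mxE [RHS](reindex (@enum_val A A)) /=; last exact: onW_bij (enum_val_bij _).
by apply: eq_bigr => i _; rewrite mxE enum_rankK enum_valK.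
Qed.

Lemma inj_kernelP (A C : finType) (M : A -> C -> F) :
  inj_kernel M <-> row_free (kernel_mx M).
Proof.
split=> [injM | freeM u uM a].
  rewrite -kermx_eq0; apply/eqP/row_matrixP => i; rewrite row0.
  have kv : row i (kermx (kernel_mx M)) *m kernel_mx M = 0.
    by rewrite -row_mul mulmx_ker row0.
  move: (row i _) kv => v kv; apply/rowP => j; rewrite !mxE.
  rewrite -(enum_valK j); apply: (injM (fun a => v 0 (enum_rank a))) => c.
  by rewrite -mul_kernel_mx kv mxE.
pose v : 'rV_#|A| := \row_i u (enum_val i).
have v0 : v = 0.
  apply: (row_free_inj freeM); rewrite mul0mx; apply/rowP => j.
  rewrite -(enum_valK j) mul_kernel_mx mxE -[RHS](uM (enum_val j)).
  by apply: eq_bigr => b _; rewrite mxE enum_rankK.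
by have := congr1 (fun w : 'rV__ => w 0 (enum_rank a)) v0; rewrite !mxE enum_rankK.
Qed.

Lemma inj_kernel_card (A C : finType) (M : A -> C -> F) :
  inj_kernel M -> (#|A| <= #|C|)%N.
Proof. by move=> /inj_kernelP /eqP <-; exact: rank_leq_col. Qed.

Lemma kernel_basis (A C : finType) (M : A -> C -> F) :
  exists (n : nat) (K : 'I_n -> A -> F),
    [/\ (#|A| <= n + #|C|)%N, inj_kernel K & forall i c, \sum_a K i a * M a c = 0].
Proof.
pose R := row_base (kermx (kernel_mx M)).
exists (\rank (kermx (kernel_mx M))), (fun i a => R i (enum_rank a)); split.
- by have := rank_leq_col (kernel_mx M); rewrite mxrank_ker; lia.
- move=> u uR i; pose v : 'rV_(\rank (kermx (kernel_mx M))) := \row_k u k.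
  have v0 : v = 0.
    apply: (row_free_inj (row_base_free (kermx (kernel_mx M)))).
    rewrite mul0mx; apply/rowP => j; rewrite -(enum_valK j) !mxE -[RHS](uR (enum_val j)).
    by apply: eq_bigr => k _; rewrite mxE.
  by have := congr1 (fun w : 'rV__ => w 0 i) v0; rewrite !mxE.
- move=> i c; have RM : row i R *m kernel_mx M = 0.
    by apply/sub_kermxP; rewrite (submx_trans (row_sub _ _)) // eq_row_base.
  have := mul_kernel_mx M (row i R) c; rewrite RM [LHS]mxE => kM; rewrite [RHS]kM.
  by apply: eq_bigr => a _; rewrite [in RHS]mxE.
Qed.

Lemma kernel_nonzero (A C : finType) (M : A -> C -> F) :
  (#|C| < #|A|)%N ->
  exists u : A -> F, (exists a, u a != 0) /\ forall c, \sum_a u a * M a c = 0.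
Proof.
move=> ltCA; have [n [K [le_n injK KM]]] := kernel_basis M.
case: n => [|n] in K le_n injK KM *; first by rewrite add0n leqNgt ltCA in le_n.
exists (K ord0); split=> //; apply/existsP; apply: contraT => /existsPn K0.
(* If [K ord0] vanished, the coefficient vector supported at [ord0] would contradict [injK]. *)
have /eqP := oner_neq0 F; case; rewrite -[RHS](injK (fun i => (i == ord0)%:R) _ ord0) ?eqxx // => a.
rewrite big_ord_recl eqxx mul1r big1 ?addr0 => [|i _]; last by rewrite eq_sym mul0r.
by apply/eqP; have := K0 a; rewrite negbK.
Qed.

Lemma inj_kernel_perm (A C : finType) (pi : A -> C) :
  injective pi -> inj_kernel (fun a c => (c == pi a)%:R).
Proof.
move=> inj_pi u uM a; rewrite -[RHS](uM (pi a)) (bigD1 a) //= eqxx mulr1.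
rewrite big1 ?addr0 // => b /negPf nba.
by rewrite (inj_eq inj_pi) eq_sym nba mulr0.
Qed.
End InjectiveKernels.

(** * Generic properties of points of an affine space *)

Section Generic.
Variable F : closedFieldType.

Definition polynomial_fun (I : Type) (h : (I -> F) -> F) : Prop :=
  exists e : pexpr F I, forall x, peval x e = h x.

Lemma polynomial_fun_const I c : polynomial_fun (fun _ : I -> F => c).
Proof. by exists (PConst I c). Qed.

Lemma polynomial_fun_var I i : polynomial_fun (fun x : I -> F => x i).
Proof. by exists (PVar F i). Qed.

Lemma polynomial_funM I (g h : (I -> F) -> F) :
  polynomial_fun g -> polynomial_fun h -> polynomial_fun (fun x => g x * h x).
Proof. by move=> [e ge] [e' he]; exists (PMul e e') => x /=; rewrite ge he. Qed.

Lemma polynomial_fun_sum I (J : Type) (s : seq J) (P : pred J) (h : J -> (I -> F) -> F) :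
  (forall j, polynomial_fun (h j)) ->
  polynomial_fun (fun x => \sum_(j <- s | P j) h j x).
Proof.
move=> hP; elim: s => [|j s [e he]].
  by exists (PConst I 0) => x; rewrite big_nil.
have [e' he'] := hP j; case Pj: (P j).
  by exists (PAdd e' e) => x /=; rewrite big_cons Pj he he'.
by exists e => x; rewrite big_cons Pj he.
Qed.

Lemma polynomial_fun_prod I (J : Type) (s : seq J) (P : pred J) (h : J -> (I -> F) -> F) :
  (forall j, polynomial_fun (h j)) ->
  polynomial_fun (fun x => \prod_(j <- s | P j) h j x).
Proof.
move=> hP; elim: s => [|j s [e he]].
  by exists (PConst I 1) => x; rewrite big_nil.
have [e' he'] := hP j; case Pj: (P j).
  by exists (PMul e' e) => x /=; rewrite big_cons Pj he he'.
by exists e => x; rewrite big_cons Pj he.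
Qed.

Lemma polynomial_fun_line I (h : (I -> F) -> F) (x y : I -> F) :
  polynomial_fun h ->
  exists p : {poly F}, forall c, p.[c] = h (fun i => x i + c * (y i - x i)).
Proof.
case=> e he; suff [p pE] : exists p : {poly F},
    forall c, p.[c] = peval (fun i => x i + c * (y i - x i)) e.
  by exists p => c; rewrite pE he.
elim: e {he} => [a|i|e1 [p pE] e2 [q qE]|e1 [p pE] e2 [q qE]].
- by exists a%:P => c; rewrite hornerC.
- by exists ((x i)%:P + 'X * (y i - x i)%:P) => c; rewrite !hornerE.
- by exists (p + q) => c; rewrite hornerD pE qE.
- by exists (p * q) => c; rewrite hornerM pE qE.
Qed.

(** A single polynomial defines the open set, so that intersections become products. *)
Definition generic (I : Type) (P : (I -> F) -> Prop) : Prop :=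
  exists h, [/\ polynomial_fun h, exists x, h x != 0 & forall x, h x != 0 -> P x].

Lemma generic_imp I (P Q : (I -> F) -> Prop) :
  (forall x, P x -> Q x) -> generic P -> generic Q.
Proof. by move=> PQ [h [hp hx hP]]; exists h; split=> // x /hP/PQ. Qed.

Lemma polynomial_fun_ext I (h : (I -> F) -> F) (x y : I -> F) :
  polynomial_fun h -> x =1 y -> h x = h y.
Proof.
case=> e he xy; rewrite -!he.
by elim: e {he} => //= e1 -> e2 ->.
Qed.

(* Two nonempty principal open sets meet on the line joining a point of each. *)
Lemma generic_and I (P Q : (I -> F) -> Prop) :
  generic P -> generic Q -> generic (fun x => P x /\ Q x).
Proof.
move=> [g [gp [x gx] gP]] [h [hp [y hy] hQ]].
exists (fun z => g z * h z); split; first exact: polynomial_funM.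
  have [p pE] := polynomial_fun_line x y gp.
  have [q qE] := polynomial_fun_line x y hp.
  have p0 : p != 0.
    apply: contraNneq gx => p0; have := pE 0; rewrite p0 horner0 => /esym <-.
    by apply/eqP/polynomial_fun_ext => // i; rewrite mul0r addr0.
  have q0 : q != 0.
    apply: contraNneq hy => q0; have := qE 1; rewrite q0 horner0 => /esym <-.
    by apply/eqP/polynomial_fun_ext => // i; rewrite mul1r addrC subrK.
  have /closed_nonrootP[c] : p * q != 0 by rewrite mulf_neq0.
  rewrite rootM negb_or => /andP[pc qc].
  by exists (fun i => x i + c * (y i - x i)); rewrite -pE -qE mulf_neq0.
by move=> z; rewrite mulf_eq0 negb_or => /andP[/gP ? /hQ].
Qed.

Lemma generic_all I (J : eqType) (s : seq J) (P : J -> (I -> F) -> Prop) :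
  (forall j, j \in s -> generic (P j)) ->
  generic (fun x => forall j, j \in s -> P j x).
Proof.
elim: s => [|j s IHs] gP.
  exists (fun=> 1); split=> //; first exact: polynomial_fun_const.
  by exists (fun=> 0); rewrite oner_neq0.
have gs : generic (fun x => forall j, j \in s -> P j x).
  by apply: IHs => i si; apply: gP; rewrite inE si orbT.
apply: generic_imp (generic_and (gP j (mem_head _ _)) gs) => x [Pj Ps] i.
by rewrite inE => /predU1P[->|/Ps].
Qed.

(** With [G] a right inverse of the matrix at [x0], the determinant of [M x] times [G] is polynomial
    in [x] and equals 1 at [x0]; where it is nonzero, [M x] has a right inverse. *)
Lemma generic_inj_kernel I (A C : finType) (M : (I -> F) -> A -> C -> F) x0 :
  (forall a c, polynomial_fun (fun x => M x a c)) ->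
  inj_kernel (M x0) -> generic (fun x => inj_kernel (M x)).
Proof.
move=> Mp /inj_kernelP/row_freeP[G MG].
exists (fun x => \det (kernel_mx (M x) *m G)); split.
- apply: polynomial_fun_sum => s; apply: polynomial_funM; first exact: polynomial_fun_const.
  apply: polynomial_fun_prod => i.
  have [e he] : polynomial_fun (fun x => \sum_j M x (enum_val i) (enum_val j) * G j (s i)).
    apply: polynomial_fun_sum => j; apply: polynomial_funM; first exact: Mp.
    exact: polynomial_fun_const.
  by exists e => x; rewrite he mxE; apply: eq_bigr => j _; rewrite mxE.
- by exists x0; rewrite MG det1 oner_neq0.
- move=> x; rewrite -unitfE -unitmxE => MxG; apply/inj_kernelP/row_freeP.
  by exists (G *m invmx (kernel_mx (M x) *m G)); rewrite mulmxA mulmxV.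
Qed.

End Generic.

(** * Balanced pairs [(f, B)] and the two moves on them *)

Section Balanced.
Variable F : closedFieldType.
Implicit Types (N r s : nat) (f : nat -> {poly F}).

(* The forms f_i are dehomogenized: the condition on size (f N) excludes a common
   zero at infinity.  (f 0).[0] != 0 keeps f_0 coprime to powers of z. *)
Definition adapted_curve N r f : Prop :=
  [/\ forall i, (i <= N)%N -> (size (f i) <= r.+1)%N, size (f N) = r.+1,
      coprimep (f N) (f 0) & (f 0).[0] != 0].

(** Injectivity of [A = sum_i f_i B_i] on vectors of polynomials of degree below [s], indexed by
    [P]. *)
Definition no_syzygy N s (P Q : finType) f (B : nat -> P -> Q -> F) : Prop :=
  forall x : P -> {poly F}, (forall p, (size (x p) <= s)%N) ->
    (forall q, \sum_(i < N.+1) \sum_p B i p q *: (f i * x p) = 0) ->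
    forall p, x p = 0.

(* no_syzygy forces equality in the cardinality condition. *)
Definition balanced N r s : Prop :=
  exists (P Q : finType) f (B : nat -> P -> Q -> F),
    [/\ (0 < #|P|)%N, (#|Q| * (r + s) <= #|P| * s)%N, adapted_curve N r f
      & no_syzygy N s f B].

(** The start [s/r = 0] of the iteration: polynomials of size at most 0 vanish, so an empty [Q]
    suffices. *)
Lemma balanced_line N : (0 < N)%N -> balanced N 1 0.
Proof.
case: N => // N _.
exists unit, void, (fun i => if i == N.+1 then 'X else 1), (fun _ _ _ => 0); split.
- by rewrite card_unit.
- by rewrite card_void.
- split; rewrite ?eqxx ?size_polyX ?coprimep1 //=.
  + by move=> i _; case: ifP; rewrite ?size_polyX ?size_poly1.
  + by rewrite hornerC oner_neq0.
- by move=> x size_x _ p; apply/eqP; rewrite -size_poly_leq0.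
Qed.

Lemma size_sum_le (I : finType) n (g : I -> {poly F}) :
  (forall i, (size (g i) <= n)%N) -> (size (\sum_i g i)%R <= n)%N.
Proof. by move=> gn; apply: leq_trans (size_sum _ _ _) _; apply/bigmax_leqP. Qed.

Lemma size_mul_bound (p q : {poly F}) m n :
  (size p <= m)%N -> (size q <= n.+1)%N -> (size (p * q)%R <= m + n)%N.
Proof.
move=> pm qn; apply: leq_trans (size_polyMleq _ _) _.
by rewrite -subn1 leq_subLR add1n -addnS leq_add.
Qed.

Lemma coprimep_Xn (p : {poly F}) n : p.[0] != 0 -> coprimep 'X^n p.
Proof. by move=> p0; rewrite coprimep_expl // coprimep_sym coprimepX. Qed.

(** The new form [z^(r+s)] multiplies new unknowns indexed by [Q], through an identity matrix. The
    old terms have degree below [r + s], so the two parts vanish separately. *)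
Lemma balanced_extend N r s : (0 < s)%N -> balanced N r s -> balanced N.+1 (r + s) s.
Proof.
move=> s_gt0 [P [Q [f [B [P0 cardPQ [fr fN cop f00] noB]]]]].
pose B' i (p : P + Q) (q : Q) : F :=
  match p with inl p => if (i <= N)%N then B i p q else 0
             | inr q' => ((i == N.+1) && (q' == q))%:R end.
exists (P + Q)%type, Q, (fun i => if i == N.+1 then 'X^(r + s) else f i), B'; split.
- by rewrite card_sum addn_gt0 P0.
- rewrite card_sum; nia.
- split=> [i|||] /=; rewrite ?eqxx ?size_polyXn //.
  + rewrite leq_eqVlt => /predU1P[->|ltiN]; first by rewrite eqxx size_polyXn.
    by rewrite ltn_eqF // (leq_trans (fr i _)) // ltnS leq_addr.
  + exact: coprimep_Xn.
- move=> x size_x xB.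
  have key q : \sum_(i < N.+1) \sum_p B i p q *: (f i * x (inl p)) + 'X^(r + s) * x (inr q) = 0.
    rewrite -[RHS](xB q) [in RHS]big_ord_recr /= eqxx; congr (_ + _).
      apply: eq_bigr => i _; rewrite big_sumType /= [X in _ = _ + X]big1 => [|q' _]; last first.
        by rewrite ltn_eqF //= scale0r.
      by rewrite addr0 ltn_eqF //; apply: eq_bigr => p _; rewrite -ltnS ltn_ord.
    rewrite big_sumType /= big1 => [|p _]; last by rewrite ltnn scale0r.
    rewrite add0r (bigD1 q) //= !eqxx scale1r big1 ?addr0 // => q' /negPf nq.
    by rewrite nq andbF scale0r.
  have xr q : x (inr q) = 0.
    have := congr1 (drop_poly (r + s)) (key q).
    rewrite mulrC drop_polyDMXn ?drop_poly0r //; apply: size_sum_le => i.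
    apply: size_sum_le => p; apply: leq_trans (size_scale_leq _ _) _.
    by rewrite mulrC addnC size_mul_bound // fr // -ltnS.
  case=> [p|q]; last exact: xr.
  apply: (noB (fun p => x (inl p))) => [p'|q]; first exact: size_x.
  by rewrite -[RHS](key q) xr mulr0 addr0.
Qed.

(** Uniqueness of expansions in base [c z^t] with digits of degree below [t]. *)
Lemma digits_eq0 n t c (d : nat -> {poly F}) :
  c != 0 -> (forall j, (j < n)%N -> (size (d j) <= t)%N) ->
  \sum_(j < n) d j * (c *: 'X^t) ^+ j = 0 -> forall j, (j < n)%N -> d j = 0.
Proof.
move=> c0; elim: n d => // n IHn d size_d.
rewrite big_ord_recl expr0 mulr1.
under eq_bigr => j _ do rewrite exprS mulrCA mulrC.
rewrite -mulr_suml -scalerAr scalerAl.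
set e := \sum_(j < n) _ => de.
have e0 : c *: e = 0 by rewrite -(drop_polyDMXn (c *: e) (size_d 0 isT)) de drop_poly0r.
have {}e0 : e = 0 by apply/eqP; move/eqP: e0; rewrite scaler_eq0 (negPf c0).
case=> [_|j ltjn]; first by move: de; rewrite e0 scaler0 mul0r addr0.
by apply: (IHn (fun i => d i.+1)) => // i lti; apply: size_d.
Qed.

(* On the roots of f_N the twisted sum is a polynomial in c with constant term f_0. *)
Lemma coprime_twist N t f :
  f N != 0 -> (0 < N)%N -> coprimep (f N) (f 0) ->
  exists2 c, c != 0 & coprimep (f N) (\sum_(j < N) f j * (c *: 'X^t) ^+ j).
Proof.
move=> fN0 N_gt0 cop.
have [rs fNE] := closed_field_poly_normal (f N).
(* [ev a] is the value of the twisted sum at [a], as a polynomial in [c]. *)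
pose ev a : {poly F} := \sum_(j < N) ((f j).[a] * a ^+ t ^+ j) *: 'X^j.
have ev0 a : root (f N) a -> ev a != 0.
  move=> ra; apply: contraTneq (Pdiv.ClosedField.coprimepP _ _ cop a ra) => e0.
  have := congr1 (fun p : {poly F} => p`_0) e0.
  case: N N_gt0 @ev e0 {fN0 cop fNE ra} => // N _ ev e0.
  rewrite coef0 /ev coef_sum big_ord_recl big1 => [|i _]; rewrite coefZ coefXn ?mulr0 //.
  by rewrite expr0 !mulr1 addr0 => ->; rewrite eqxx.
(* The factor ['X] makes the chosen [c] nonzero. *)
have /closed_nonrootP[c] : 'X * \prod_(a <- rs) ev a != 0.
  rewrite mulf_neq0 ?polyX_eq0 // prodf_seq_neq0.
  apply/allP => a rsa /=; apply: ev0; rewrite fNE rootZ ?lead_coef_eq0 //.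
  by rewrite root_prod_XsubC.
rewrite rootM rootX negb_or => /andP[c0 nroot]; exists c => //.
apply/Pdiv.ClosedField.coprimepP => a ra.
apply: contraNneq nroot => Fa0; rewrite /root horner_prod.
have rsa : a \in rs by move: ra; rewrite fNE rootZ ?lead_coef_eq0 // root_prod_XsubC.
rewrite (big_rem a rsa) /= mulf_eq0; apply/orP; left; apply/eqP.
rewrite -[RHS]Fa0 !horner_sum; apply: eq_bigr => j _.
by rewrite !hornerE exprMn; ring.
Qed.

(* The vectors y orthogonal to the curve (- f_N w^j, G) are the multiples of f: f_N
   divides y_N, and the base-w digits y_j are then determined because deg y_j < r + s. *)
Lemma twisted_annihilator N r s f c (y : nat -> {poly F}) :
  let w := c *: 'X^(r + s) in let G := \sum_(j < N) f j * w ^+ j in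
  adapted_curve N r f -> c != 0 -> coprimep (f N) G ->
  (forall i, (i <= N)%N -> (size (y i) <= r + s)%N) ->
  y N * G = f N * \sum_(j < N) y j * w ^+ j ->
  exists2 al : {poly F}, (size al <= s)%N & forall i, (i <= N)%N -> y i = al * f i.
Proof.
move=> w G [fr fN _ _] c0 copG size_y yG.
have fN0 : f N != 0 by rewrite -size_poly_eq0 fN.
have [al yN] : exists al : {poly F}, y N = al * f N.
  by apply/dvdpP; rewrite -(Gauss_dvdpl _ copG) yG dvdp_mulr.
have size_al : (size al <= s)%N.
  have [->|al0] := eqVneq al 0; first by rewrite size_poly0.
  by have := size_y N (leqnn N); rewrite yN size_mul // fN addnS /= addnC leq_add2l.
exists al => // i; rewrite leq_eqVlt => /predU1P[-> //|ltiN].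
apply/eqP; rewrite -subr_eq0; apply/eqP.
apply: (@digits_eq0 N (r + s) c (fun j => y j - al * f j) c0) ltiN => [j ltjN|].
  rewrite (leq_trans (size_polyD _ _)) // geq_max size_y ?(ltnW ltjN) //= size_polyN.
  by rewrite addnC size_mul_bound // fr // ltnW.
apply: (mulfI fN0); rewrite mulr0.
under eq_bigr => j _ do rewrite mulrBl -mulrA.
by rewrite sumrB -mulr_sumr mulrBr -yG yN -/G -/w; ring.
Qed.

(** A syzygy [x] of the new pair makes each vector [y _ p] orthogonal to [g], hence equal to [al p]
    times [f]. Since [K] annihilates [B], [no_syzygy] gives [al = 0]; then [y = 0], and the
    independence of the rows of [K] gives [x = 0]. *)
Lemma balanced_reflect N r s : (0 < N)%N -> (0 < r)%N ->
  balanced N r s -> balanced N (N * r + N.-1 * s) (r + s).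
Proof.
move=> N_gt0 r_gt0 [P [Q [f [B [P0 cardPQ fA noB]]]]].
have [fr fN cop f00] := fA.
have fN0 : f N != 0 by rewrite -size_poly_eq0 fN.
have [c c0 copG] := coprime_twist (r + s) fN0 N_gt0 cop.
pose w := c *: 'X^(r + s); set G := \sum_(j < N) _ in copG.
have [n [K [le_n injK KB]]] := kernel_basis (fun (a : 'I_N.+1 * P) q => B a.1 a.2 q).
(* The entry paired with index [N] comes first: [g 0] then has the constant term of [f 0], and [g N]
   has degree exactly [N r + (N-1) s]. *)
pose g i := if i is j.+1 then - (f N * w ^+ j) else G.
pose B' i (k : 'I_n) (p : P) := if i is j.+1 then K k (inord j, p) else K k (inord N, p).
have size_w j : size (w ^+ j) = ((r + s) * j).+1.
  by rewrite exprZn -exprM size_scale ?expf_neq0 // size_polyXn.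
have w0 j : w ^+ j != 0 by rewrite -size_poly_eq0 size_w.
have G0 : G.[0] = (f 0).[0].
  rewrite horner_sum -(prednK N_gt0) big_ord_recl expr0 mulr1 big1 ?addr0 // => i _.
  by rewrite hornerM horner_exp hornerZ hornerXn expr0n addn_eq0 gtn_eqF // mulr0 expr0n mulr0.
have deg_top : (N * r + N.-1 * s = r + (r + s) * N.-1)%N.
  by case: (N) N_gt0 => // M _ /=; nia.
have deg_le j : (j < N)%N -> (r.+1 + (r + s) * j <= (N * r + N.-1 * s).+1)%N.
  by move=> ltjN; rewrite deg_top -addSn leq_add2l leq_mul2l -ltnS prednK // ltjN orbT.
have gN : g N = - (f N * w ^+ N.-1) by rewrite /g -{1}(prednK N_gt0).
exists 'I_n, P, g, B'; split.
(* With [le_n] this gives [n >= N #|P| > 0]. *)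
- have leQP : (#|Q| <= #|P|)%N.
    rewrite -(@leq_pmul2r (r + s)) ?addn_gt0 ?r_gt0 //.
    by rewrite (leq_trans cardPQ) // leq_mul2l leq_addl orbT.
  by move: le_n; rewrite card_ord card_prod card_ord; nia.
- move: le_n; rewrite card_ord card_prod card_ord -(@leq_pmul2r (r + s)) ?addn_gt0 ?r_gt0 //.
  have -> : (N * r + N.-1 * s + (r + s) = N.+1 * (r + s) - s)%N.
    by case: (N) N_gt0 => // M _ /=; nia.
  rewrite mulnDl mulnBr leq_subLR mulnA [(_ * N.+1)%N]mulnC => /leq_trans -> //.
  by rewrite addnC leq_add2r.
- split.
  + case=> [_|j ltjN].
      apply: size_sum_le => j; apply: leq_trans (deg_le j (ltn_ord j)).
      by apply: size_mul_bound; rewrite ?size_w // fr // ltnW.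
    by rewrite size_polyN (leq_trans _ (deg_le j ltjN)) // size_mul_bound ?size_w ?fN.
  + rewrite gN size_polyN size_mul // fN size_w deg_top.
    by rewrite addnS addSn.
  + rewrite gN -scaleN1r coprimepZl ?oppr_eq0 ?oner_neq0 //.
    rewrite coprimepMl copG coprimep_expl // coprimepZl // coprimep_Xn //.
    by rewrite G0.
  + by rewrite /= G0.
- move=> x size_x xg k.
  pose y i p := \sum_k K k (inord i : 'I_N.+1, p) *: x k.
  have size_y i p : (size (y i p) <= r + s)%N.
    by apply: size_sum_le => k'; apply: leq_trans (size_scale_leq _ _) _.
  have yG p : y N p * G = f N * \sum_(j < N) y j p * w ^+ j.
    apply/eqP; rewrite -subr_eq0 -[X in _ == X](xg p) big_ord_recl /= mulr_suml.
    apply/eqP; congr (_ + _).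
      by apply: eq_bigr => k' _; rewrite -scalerAl mulrC.
    rewrite mulr_sumr -sumrN; apply: eq_bigr => j _; rewrite mulr_suml mulr_sumr -sumrN.
    by apply: eq_bigr => k' _; rewrite -scalerAl -scalerAr -scalerN; congr (_ *: _); ring.
  have [al size_al yE] := fin_all_exists2 (fun p =>
    twisted_annihilator fA c0 copG (fun i _ => size_y i p) (yG p)).
  have al0 p : al p = 0.
    apply: (noB al size_al) => q.
    transitivity (\sum_(a : 'I_N.+1 * P) \sum_k (K k a * B a.1 a.2 q) *: x k).
      rewrite pair_bigA; apply: eq_bigr => -[i p'] _ /=.
      rewrite mulrC -yE -1?ltnS // scaler_sumr; apply: eq_bigr => k' _.
      by rewrite inord_val scalerA mulrC.
    by rewrite exchange_big big1 // => k' _; rewrite -scaler_suml KB scale0r.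
  apply/polyP => m; rewrite coef0; apply: (injK (fun k' => (x k')`_m) _ k) => -[i p].
  have := congr1 (fun p : {poly F} => p`_m) (yE p i (leq_ord i)).
  rewrite al0 mul0r coef0 coef_sum => yi; rewrite -[RHS]yi.
  by apply: eq_bigr => k' _; rewrite coefZ inord_val mulrC.
Qed.

End Balanced.

(** * Balanced pairs for [r <= s], from a perfect matching *)

Section Base.
Variable F : closedFieldType.

Section Matching.
Variables N r s : nat.
Hypotheses (N_gt1 : (1 < N)%N) (r_gt0 : (0 < r)%N) (le_rs : (r <= s)%N).

Definition exponent i := if i == N then r else if i == 1 then (s %% r)%N else 0%N.

(* Unit i < r + s of the source b leaves along the edge [edge b i], which is an index
   into [exponent], and arrives in place [slot b i] < s of its target. *)
Definition edge b i : nat :=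
  if (i < low_flow r s b)%N then 0 else
  if (i < low_flow r s b + mid_flow r b)%N then 1 else N.

Definition slot b i : nat :=
  if (i < low_flow r s b)%N then i else
  if (i < low_flow r s b + mid_flow r b)%N
  then (low_flow r s (b + s %% r) + (i - low_flow r s b))%N else (i - r)%N.

(** The indices are the target and the place in it. In each target the low units come first, the
    middle ones follow, and the high ones fill the top places below [s]. *)
Variant edge_spec b i : nat -> nat -> Prop :=
| EdgeLow of (i < low_flow r s b)%N & (i < s)%N : edge_spec b i b i
| EdgeMid j of (j < mid_flow r b)%N & i = (low_flow r s b + j)%N
    & (low_flow r s (b + s %% r) + j < s)%N :
    edge_spec b i (b + s %% r) (low_flow r s (b + s %% r) + j)
| EdgeHigh of (low_flow r s b + mid_flow r b <= i)%N & (i - r < s)%N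
    & (s <= i - r + high_flow r s b)%N
    : edge_spec b i (b + r) (i - r).

Lemma edgeP b i : (b < s)%N -> (i < r + s)%N ->
  edge_spec b i (b + exponent (edge b i)) (slot b i).
Proof.
move=> ltbs ltit; rewrite /edge /slot /exponent.
have rho_lt : (s %% r < r)%N by rewrite ltn_mod.
have row := flow_row r_gt0 le_rs ltbs.
have [lt_low|ge_low] := ltnP i (low_flow r s b).
  rewrite eq_sym (gtn_eqF (ltnW N_gt1)) addn0.
  have := flow_col r_gt0 le_rs (leq_trans ltbs (leq_addl r s)) => col.
  by constructor => //; lia.
have [lt_mid|ge_mid] := ltnP.
  rewrite eq_sym (gtn_eqF N_gt1) eqxx; constructor; try lia.
  have /(flow_col r_gt0 le_rs) : (b + s %% r < r + s)%N by lia.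
  by rewrite leq_addl addnK; lia.
rewrite eqxx.
have /(flow_col r_gt0 le_rs) : (b + r < r + s)%N by lia.
by rewrite leq_addl addnK /high_flow => col; constructor=> //; rewrite /high_flow; lia.
Qed.

(** Units arriving at one target along different edges lie in disjoint intervals, because [flow_col]
    bounds their total length by [s]. *)
Lemma edge_inj b i b' i' :
  (b < s)%N -> (i < r + s)%N -> (b' < s)%N -> (i' < r + s)%N ->
  (b + exponent (edge b i) = b' + exponent (edge b' i'))%N ->
  slot b i = slot b' i' -> b = b' /\ i = i'.
Proof.
move=> ltbs ltit ltbs' ltit'.
have rho_lt : (s %% r < r)%N by rewrite ltn_mod.
have low_col c := flow_col r_gt0 le_rs (c := c).
have high_le a : (a < s)%N -> (high_flow r s a <= s)%N.
  move=> ltas; have /low_col : (a + r < r + s)%N by lia.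
  by rewrite leq_addl addnK; lia.
have mid_col a : (a < s)%N ->
    (low_flow r s (a + s %% r) + mid_flow r a
     + (if (r <= a + s %% r)%N then high_flow r s (a + s %% r - r) else 0) <= s)%N.
  move=> ltas; have /low_col : (a + s %% r < r + s)%N by lia.
  by rewrite leq_addl addnK.
have high_col a : (a < s)%N -> (low_flow r s (a + r) + high_flow r s a <= s)%N.
  move=> ltas; have /low_col : (a + r < r + s)%N by lia.
  by rewrite leq_addl addnK; lia.
have high_ge a : (a < s)%N -> (r <= low_flow r s a + mid_flow r a)%N.
  by move=> ltas; have := high_le a ltas; rewrite /high_flow; lia.
have mid_high a a' j : (a < s)%N -> (j < mid_flow r a)%N ->
    (a + s %% r = a' + r)%N ->
    (low_flow r s (a + s %% r) + j + high_flow r s a' < s)%N.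
  by move=> ltas ltj eqc; have := mid_col a ltas; rewrite eqc leq_addl addnK; lia.
case: (edgeP ltbs ltit); case: (edgeP ltbs' ltit').
- by move=> *; lia.
- by move=> j ltj iE _ lti _ eb; rewrite eb in lti *; lia.
- move=> gei _ geS lti _ eb es; have := high_col b' ltbs'; rewrite -eb; lia.
- by move=> lti _ j ltj iE _ eb; rewrite -eb in lti *; lia.
- move=> j' ltj' iE' _ j ltj iE _ /addIn eb; rewrite eb in iE *; lia.
- by move=> gei _ geS j ltj iE _ /(mid_high _ _ _ ltbs ltj); lia.
- move=> lti _ gei _ geS eb es; have := high_col b ltbs; rewrite eb; lia.
- by move=> j ltj iE _ gei _ geS /esym/(mid_high _ _ _ ltbs' ltj); lia.
- move=> gei' _ _ gei _ _ /addIn eb; rewrite eb in gei *.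
  by have := high_ge b' ltbs'; lia.
Qed.

Lemma edge_le b i : (edge b i <= N)%N.
Proof. by rewrite /edge; case: ifP => // _; case: ifP => // _; exact: ltnW. Qed.
End Matching.

(* The part of weight k of sum_a z^(exponent a) B_a for the Z/s-grading giving z
   weight 1 and index j weight j.  Within one block the entries are distinct variables. *)
Definition block N r s' (k : 'I_s'.+1)
    (beta : 'I_s'.+1 * 'I_N.+1 * 'I_(r + s'.+1) * 'I_s'.+1 -> F)
    (p : 'I_s'.+1 * 'I_(r + s'.+1)) (q : 'I_(r + s'.+1) * 'I_s'.+1) : F :=
  \sum_(a < N.+1) ((q.1 : nat) == (p.1 + exponent N r s'.+1 a)%N)%:R
    * beta (k - p.1, a, p.2, q.2).

Lemma block_generic N r s' (k : 'I_s'.+1) :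
  (1 < N)%N -> (0 < r)%N -> (r <= s'.+1)%N ->
  generic (fun beta => inj_kernel (@block N r s' k beta)).
Proof.
move=> N_gt1 r_gt0 le_rs.
(* At this point the block is the 0-1 matrix of the matching [pi]. The first index of a variable is
   [k - p.1], so the source is recovered as [k - j]. *)
apply: (generic_inj_kernel (M := @block N r s' k) (x0 := fun z => let: (j, a, i, i') := z in
  (((a : nat) == edge N r s'.+1 (k - j)%R i) && ((i' : nat) == slot r s'.+1 (k - j)%R i))%:R)).
  move=> p q; apply: polynomial_fun_sum => a; apply: polynomial_funM.
    exact: polynomial_fun_const.
  exact: polynomial_fun_var.
have bounds (p : 'I_s'.+1 * 'I_(r + s'.+1)) :
    (p.1 + exponent N r s'.+1 (edge N r s'.+1 p.1 p.2) < r + s'.+1)%N /\ (slot r s'.+1 p.1 p.2 < s'.+1)%N.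
  case: (edgeP N_gt1 r_gt0 le_rs (ltn_ord p.1) (ltn_ord p.2)).
  - by move=> _ ->; rewrite ltn_addl.
  - move=> j _ _ ->; split=> //.
    by have := ltn_ord p.1; have : (s'.+1 %% r < r)%N by [rewrite ltn_mod]; lia.
  - by move=> _ -> _; rewrite addnC ltn_add2l.
pose pi (p : 'I_s'.+1 * 'I_(r + s'.+1)) := (Ordinal (bounds p).1, Ordinal (bounds p).2).
have inj_pi : injective pi.
  move=> [b i] [b' i'] [/= eb ei].
  have [] := edge_inj N_gt1 r_gt0 le_rs (ltn_ord b) (ltn_ord i) (ltn_ord b') (ltn_ord i') eb ei.
  by move=> /val_inj -> /val_inj ->.
have := inj_kernel_perm (F := F) inj_pi.
rewrite /inj_kernel => inj u uM; apply: inj => q; rewrite -[RHS](uM q).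
apply: eq_bigr => p _; congr (_ * _); rewrite /block.
have kp : k - (k - p.1) = p.1 by rewrite subKr.
under [RHS]eq_bigr => a _ do rewrite kp.
rewrite (bigD1 (inord (edge N r s'.+1 p.1 p.2))) //= inordK ?ltnS ?edge_le // eqxx /=.
rewrite big1 ?addr0 => [|a /negPf na]; last first.
  rewrite [(a : nat) == _](_ : _ = false) ?mulr0 //.
  by apply: contraFF na => /eqP <-; rewrite inord_val.
by case: q => c i'; rewrite -natrM mulnb xpair_eqE -!val_eqE.
Qed.

Lemma balanced_base N r s : (1 < N)%N -> (0 < r)%N -> (r <= s)%N -> balanced F N r s.
Proof.
move=> N_gt1 r_gt0; case: s => [|s']; first by rewrite leqNgt r_gt0.
move=> le_rs; pose d := exponent N r s'.+1.
have d_le a : (d a <= r)%N.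
  by rewrite /d /exponent; case: ifP => // _; case: ifP => // _; rewrite ltnW // ltn_mod.
have [h [_ [beta /[swap] hP /hP inj]]] :=
  generic_all (s := enum 'I_s'.+1) (fun k _ => block_generic k N_gt1 r_gt0 le_rs).
pose B a (p : 'I_s'.+1 * 'I_(r + s'.+1)) (q : 'I_s'.+1 * 'I_s'.+1) : F :=
  (p.1 == q.1 + inZp (d a))%:R * beta (p.1, inord a, p.2, q.2).
exists ('I_s'.+1 * 'I_(r + s'.+1))%type, ('I_s'.+1 * 'I_s'.+1)%type, (fun a => 'X^(d a)), B; split.
- by rewrite card_prod !card_ord muln_gt0 addn_gt0 r_gt0.
- by rewrite !card_prod !card_ord mulnAC.
- have d0 : d 0%N = 0%N by rewrite /d /exponent eq_sym gtn_eqF // ltnW.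
  split; rewrite ?d0 ?coprimep1 ?hornerE ?oner_neq0 //.
  + by move=> a _; rewrite size_polyXn ltnS.
  + by rewrite size_polyXn /d /exponent eqxx.
move=> x size_x xB.
(* The unknowns of weight [k] are the coefficients of [z^b] in the entries with index [k - b]; the
   coefficient of [z^c] in equation [k - c] involves only these. *)
have xcoef k b i : (x (k - b, i))`_(b : 'I_s'.+1) = 0.
  apply: (inj k (mem_enum _ _) (fun p => (x (k - p.1, p.2))`_p.1) _ (b, i)) => -[c i'].
  have := congr1 (fun p : {poly F} => p`_c) (xB (k - inZp c, i')).
  rewrite coef0 coef_sum => xc; rewrite -[RHS]xc.
  under eq_bigr => p _ do rewrite mulr_sumr.
  rewrite exchange_big /=; apply: eq_bigr => a _; rewrite coef_sum.
  transitivity (\sum_i1 \sum_(b' < s'.+1) (x (k - b', i1))`_b'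
      * (((c : nat) == (b' + d a)%N)%:R * beta (k - b', a, i1, i'))).
    by rewrite exchange_big pair_bigA; apply: eq_bigr => -[b1 i1].
  transitivity (\sum_i1 \sum_j ((j == k - inZp c + inZp (d a))%:R * beta (j, a, i1, i'))
      * (if (c < d a)%N then 0 else (x (j, i1))`_(c - d a))); last first.
    rewrite exchange_big pair_bigA; apply: eq_bigr => -[j i1] _.
    by rewrite coefZ coefXnM /B /= inord_val.
  apply: eq_bigr => i1 _.
  have [lt_cd|le_dc] := ltnP c (d a).
    rewrite big1 => [|b' _]; last first.
      by rewrite ltn_eqF ?mul0r ?mulr0 // ltn_addl.
    by rewrite big1 // => j _; rewrite mulr0.
  rewrite [RHS](bigD1 (k - inZp c + inZp (d a))) //= eqxx mul1r [X in _ + X]big1 ?addr0; last first.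
    by move=> j /negPf ->; rewrite !mul0r.
  have -> : k - inZp c + inZp (d a) = k - inZp (c - d a).
    have -> : (inZp c : 'I_s'.+1) = inZp (c - d a) + inZp (d a).
      by apply: val_inj; rewrite /= modnDm subnK.
    by rewrite opprD addrA subrK.
  (* Only [b' = c - d a] contributes; if it is not below [s'.+1], the coefficient of [x] vanishes by
     [size_x]. *)
  have [lt_s|ge_s] := ltnP (c - d a) s'.+1; last first.
    rewrite [(x _)`_(c - d a)]nth_default ?(leq_trans (size_x _)) // mulr0.
    rewrite big1 // => b' _; rewrite [_ == _](_ : _ = false) ?mul0r ?mulr0 //.
    by apply/eqP => cE; rewrite cE addnK leqNgt ltn_ord in ge_s.
  have -> : (inZp (c - d a) : 'I_s'.+1) = Ordinal lt_s by apply: val_inj; rewrite /= modn_small.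
  rewrite (bigD1 (Ordinal lt_s)) //= subnK // eqxx mul1r big1 ?addr0 => [|b' nb].
    by rewrite mulrC.
  rewrite [_ == _](_ : _ = false) ?mul0r ?mulr0 //; apply/eqP => cE.
  by move/eqP: nb; apply; apply: val_inj; rewrite /= cE addnK.
case=> j i; apply/polyP => b; rewrite coef0.
have [ltbs|lebs] := ltnP b s'.+1; last by rewrite nth_default // (leq_trans (size_x _)).
by have := xcoef (j + Ordinal ltbs) (Ordinal ltbs) i; rewrite addrK.
Qed.

End Base.

(** * Existence of balanced pairs whenever [d <= 1] *)

Section Exist.
Variable F : closedFieldType.

(** Lowering [r] by [s] costs one form and preserves the bound [r <= N.-1 * s], until [r <= s]. *)
Lemma balanced_wide N r s : (1 < N)%N -> (0 < r)%N -> (r <= N.-1 * s)%N -> balanced F N r s.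
Proof.
move=> N_gt1; elim: N N_gt1 r => // N IHN N_gt0 r r_gt0 le_rNs.
have [le_rs|lt_sr] := leqP r s; first exact: balanced_base.
have N_gt1 : (1 < N)%N by case: N N_gt0 le_rNs {IHN} => // -[|//] _; lia.
rewrite -(subnK (ltnW lt_sr)); apply: balanced_extend.
  by rewrite lt0n; apply: contraTneq le_rNs => ->; rewrite muln0 -ltnNge.
apply: IHN => //; first by rewrite subn_gt0.
by rewrite -(leq_add2r s) subnK ?(ltnW lt_sr) // addnC -mulSn prednK // ltnW.
Qed.

(** Outside the wide range, the inverse reflection lowers [r + s] and keeps [d]. It can end at
    [s = 0], where [d <= 1] forces [r = 1]. *)
Lemma balanced_exists N r s : (1 < N)%N -> (0 < r)%N ->
  (r ^ 2 <= N.-1 * (s * (r + s)) + 1)%N -> balanced F N r s.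
Proof.
move=> N_gt1; have [n] := ubnP (r + s); elim: n r s => // n IHn r s le_n r_gt0 q_le1.
have [le_r|lt_r] := leqP r (N.-1 * s); first exact: balanced_wide.
have [s0|s_gt0] := posnP s.
  have -> : r = 1%N by move: q_le1; rewrite s0 mul0n muln0; nia.
  by rewrite s0; apply: balanced_line; apply: ltnW.
have [r0 [s0 [r0_gt0 sE rE qE]]] := reflection_descent (ltnW N_gt1) lt_r q_le1 s_gt0.
rewrite [X in balanced _ _ X]rE -[X in balanced _ _ _ X]sE.
apply: balanced_reflect => //; first exact: ltnW.
by apply: IHn => //; rewrite sE; lia.
Qed.

End Exist.

(** * Products of forms and of subspaces *)

Section Hmul.
Variables (F : fieldType) (a b : nat).

Lemma coef_hmul (f : 'rV[F]_a.+1) (g : 'rV[F]_b.+1) c :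
  hmul f g 0 c = (rVpoly f * rVpoly g)`_c.
Proof. by rewrite mxE. Qed.

Lemma hmul_suml (I : finType) (k : I -> F) (f : I -> 'rV[F]_a.+1) (g : 'rV[F]_b.+1) :
  hmul (\sum_i k i *: f i) g = \sum_i k i *: hmul (f i) g.
Proof.
rewrite /hmul linear_sum /= mulr_suml linear_sum /=; apply: eq_bigr => i _.
by rewrite linearZ /= -scalerAl linearZ.
Qed.

Lemma hmul_sumr (I : finType) (k : I -> F) (f : 'rV[F]_a.+1) (g : I -> 'rV[F]_b.+1) :
  hmul f (\sum_i k i *: g i) = \sum_i k i *: hmul f (g i).
Proof.
rewrite /hmul linear_sum /= mulr_sumr linear_sum /=; apply: eq_bigr => i _.
by rewrite linearZ /= -scalerAr linearZ.
Qed.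

Lemma hmul_prodS (V : {vspace 'rV[F]_a.+1}) (W : {vspace 'rV[F]_b.+1}) f g :
  f \in V -> g \in W -> hmul f g \in prodS V W.
Proof.
move=> Vf Wg; rewrite (coord_vbasis Vf) (coord_vbasis Wg) hmul_suml.
apply: memv_suml => i _; apply: memvZ; rewrite hmul_sumr.
apply: memv_suml => j _; apply: memvZ; apply: memv_span.
by apply: allpairs_f; apply: mem_nth; rewrite size_tuple.
Qed.

Lemma prodS_sub (V : {vspace 'rV[F]_a.+1}) (W : {vspace 'rV[F]_b.+1})
    (Z : {vspace 'rV[F]_(a + b).+1}) :
  (forall f g, f \in V -> g \in W -> hmul f g \in Z) -> (prodS V W <= Z)%VS.
Proof.
move=> VWZ; apply/span_subvP => _ /allpairsP[[f g] /= [Vf Wg ->]].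
by apply: VWZ; apply: vbasis_mem.
Qed.
End Hmul.

Lemma row_rowsp (F : fieldType) k n (A : 'M[F]_(k, n)) i : row i A \in rowsp A.
Proof. by apply: memv_span; apply: map_f; rewrite mem_enum. Qed.

(** * From an injective [A] to the dimension inequality *)

Section Semistable.
Variable F : closedFieldType.
Variables (N r s' : nat) (P Q : finType) (B : nat -> P -> Q -> F).

(** The matrix of [A] in monomial bases, the rows of [x] being the forms [f_i]. *)
Definition mult_kernel (x : 'I_N.+1 * 'I_r.+1 -> F)
    (a : P * 'I_s'.+1) (c : Q * 'I_(r + s').+1) : F :=
  \sum_(i < N.+1) B i a.1 c.1 * (rVpoly (row i (mx_of x)) * 'X^(a.2))`_c.2.

Lemma mult_kernel_polynomial a c : polynomial_fun (fun x => mult_kernel x a c).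
Proof.
apply: polynomial_fun_sum => i; apply: polynomial_funM; first exact: polynomial_fun_const.
have [lt|le] := ltnP c.2 a.2.
  by exists (PConst _ 0) => x; rewrite coefMXn lt.
case: (insubP 'I_r.+1 (c.2 - a.2)%N) => [j _ jE|nj].
  by exists (PVar _ (i, j)) => x; rewrite coefMXn ltnNge le /= -jE coef_rVpoly_ord !mxE.
by exists (PConst _ 0) => x; rewrite coefMXn ltnNge le /= coef_rVpoly insubN.
Qed.

Lemma sum_mult_kernel x (X : P -> 'rV[F]_s'.+1) c :
  \sum_a X a.1 0 a.2 * mult_kernel x a c =
  (\sum_(i < N.+1) \sum_p B i p c.1 *: hmul (row i (mx_of x)) (X p)) 0 c.2.
Proof.
rewrite summxE; under eq_bigr => a _ do rewrite mulr_sumr.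
rewrite exchange_big; apply: eq_bigr => i _ /=.
rewrite summxE -(pair_bigA _ (fun p b => X p 0 b * (B i p c.1 * (rVpoly (row i (mx_of x)) * 'X^b)`_c.2))).
apply: eq_bigr => p _ /=; rewrite mxE coef_hmul.
have -> : rVpoly (X p) = \sum_(b < s'.+1) X p 0 b *: 'X^b.
  by rewrite [LHS]poly_def; apply: eq_bigr => b _; rewrite valK.
rewrite mulr_sumr coef_sum mulr_sumr; apply: eq_bigr => b _.
by rewrite -scalerAr coefZ mulrCA.
Qed.

(** [A] restricts to an injective map from [W^P] to [(VW)^Q]; [M] below is its matrix in bases of
    [W] and [VW]. *)
Lemma mult_kernel_semistable x (W : {vspace 'rV[F]_s'.+1}) :
  inj_kernel (mult_kernel x) ->
  (#|P| * \dim W <= #|Q| * \dim (prodS (rowsp (mx_of x)) W))%N.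
Proof.
move=> injM; set V := rowsp _; set VW := prodS V W.
pose M (a : P * 'I_(\dim W)) (c : Q * 'I_(\dim VW)) : F :=
  coord (vbasis VW) c.2 (\sum_(i < N.+1) B i a.1 c.1 *: hmul (row i (mx_of x)) (vbasis W)`_a.2).
suff /inj_kernel_card : inj_kernel M by rewrite !card_prod !card_ord.
move=> u uM; pose X p := \sum_(k < \dim W) u (p, k) *: (vbasis W)`_k.
have out0 q : \sum_(i < N.+1) \sum_p B i p q *: hmul (row i (mx_of x)) (X p) = 0.
  set y := LHS.
  have yVW : y \in VW.
    apply: memv_suml => i _; apply: memv_suml => p _; apply: memvZ.
    apply: hmul_prodS; first exact: row_rowsp.
    by apply: memv_suml => k _; apply: memvZ; apply: vbasis_mem; apply: mem_nth; rewrite size_tuple.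
  rewrite (coord_vbasis yVW) big1 // => l _; rewrite [coord _ _ _](_ : _ = 0) ?scale0r //.
  rewrite -[RHS](uM (q, l)) /M /=.
  transitivity (\sum_p \sum_(k < \dim W) u (p, k) * coord (vbasis VW) l
     (\sum_(i < N.+1) B i p q *: hmul (row i (mx_of x)) (vbasis W)`_k)); last first.
    by rewrite pair_bigA; apply: eq_bigr => -[p k].
  rewrite /y exchange_big linear_sum; apply: eq_bigr => p _ /=.
  under [RHS]eq_bigr => k _ do rewrite -linearZ.
  rewrite -linear_sum; congr (coord _ _ _).
  under [RHS]eq_bigr => k _ do rewrite scaler_sumr.
  rewrite exchange_big; apply: eq_bigr => i _; rewrite hmul_sumr scaler_sumr.
  by apply: eq_bigr => k _; rewrite !scalerA mulrC.
have X0 p : X p = 0.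
  apply/rowP => b; rewrite [RHS]mxE.
  apply: (injM (fun a => X a.1 0 a.2) _ (p, b)) => c.
  by rewrite sum_mult_kernel out0 mxE.
case=> p k; have /freeP free := basis_free (vbasisP W).
exact: (free (fun k => u (p, k)) (X0 p)).
Qed.

End Semistable.

(** * Genericity on the Grassmannian *)

Lemma full_rank_generic (F : closedFieldType) k n : (k <= n)%N ->
  generic (fun x : 'I_k * 'I_n -> F => \rank (mx_of x) = k).
Proof.
move=> le_kn.
have full x : inj_kernel (fun (i : 'I_k) (j : 'I_n) => x (i, j) : F) -> \rank (mx_of x) = k.
  move=> inj; apply/eqP; apply: inj_row_free => v vA; apply/rowP => i; rewrite [RHS]mxE.
  apply: (inj (fun i => v 0 i)) => j; have := congr1 (fun w : 'rV_n => w 0 j) vA.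
  rewrite !mxE => vj; rewrite -[RHS]vj; apply: eq_bigr => l _; by rewrite !mxE.
pose M (x : 'I_k * 'I_n -> F) (i : 'I_k) (j : 'I_n) := x (i, j).
have Mp i j : polynomial_fun (fun x => M x i j) by exact: polynomial_fun_var.
have M0 : inj_kernel (M (fun ij => ((ij.2 : nat) == ij.1)%:R)).
  by apply: (inj_kernel_perm (pi := widen_ord le_kn)) => i j [/val_inj].
exact: generic_imp full (generic_inj_kernel Mp M0).
Qed.

Lemma generic_general (F : closedFieldType) k n (P : {vspace 'rV[F]_n} -> Prop) :
  (k <= n)%N -> generic (fun x : 'I_k * 'I_n -> F => P (rowsp (mx_of x))) ->
  general_subspace k P.
Proof.
move=> /(full_rank_generic F) gfull gP.
have [h [[e he] [x hx] hP]] := generic_and gfull gP.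
exists (fun x => h x != 0); split; [|by exists x|exact: hP].
by exists [:: e] => y; rewrite /= orbF he.
Qed.

Lemma etaS_le (F : fieldType) m n s t (W : {vspace 'rV[F]_m}) (Z : {vspace 'rV[F]_n}) :
  (0 < s)%N -> (0 < t)%N -> (etaS s W <= etaS t Z) = (\dim W * t <= \dim Z * s)%N.
Proof.
move=> s0 t0; rewrite /etaS ler_pdivrMr ?ltr0n // mulrAC ler_pdivlMr ?ltr0n //.
by rewrite -!natrM ler_nat.
Qed.

Lemma balanced_generic (F : closedFieldType) N r s' : balanced F N r s'.+1 ->
  generic (fun x : 'I_N.+1 * 'I_r.+1 -> F =>
    forall W : {vspace 'rV[F]_s'.+1}, W != 0%VS ->
      etaS s'.+1 W <= etaS (r + s'.+1) (prodS (rowsp (mx_of x)) W)).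
Proof.
move=> [P [Q [f [B [P0 cardPQ [fr _ _ _] noB]]]]].
have M0 : inj_kernel (mult_kernel (N := N) (r := r) (s' := s') B (fun ij => (f ij.1)`_ij.2)).
  move=> u uM [p b]; pose X p : 'rV[F]_s'.+1 := \row_b u (p, b).
  suff : rVpoly (X p) = 0.
    move/(congr1 (fun q : {poly F} => q`_b)).
    by rewrite coef_rVpoly_ord mxE coef0.
  apply: (noB (fun p => rVpoly (X p))) => [p'|q]; first exact: size_poly.
  have rowE (i : 'I_N.+1) : row i (mx_of (fun ij : 'I_N.+1 * 'I_r.+1 => (f ij.1)`_ij.2)) = poly_rV (f i).
    by apply/rowP => j; rewrite !mxE.
  apply/polyP => c; rewrite coef0.
  have [ltc|gec] := ltnP c (r + s').+1; last first.
    rewrite nth_default //; apply: leq_trans gec; rewrite -addnS.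
    apply: size_sum_le => i; apply: size_sum_le => p'.
    apply: leq_trans (size_scale_leq _ _) _; rewrite mulrC addnC size_mul_bound ?size_poly //.
    by rewrite fr // -ltnS.
  rewrite -[RHS](uM (q, Ordinal ltc)).
  transitivity (\sum_a X a.1 0 a.2 *
      mult_kernel (N := N) (r := r) (s' := s') B (fun ij => (f ij.1)`_ij.2) a (q, Ordinal ltc)); last first.
    by apply: eq_bigr => -[p' b'] _; rewrite mxE.
  rewrite sum_mult_kernel summxE coef_sum; apply: eq_bigr => i _.
  rewrite summxE coef_sum; apply: eq_bigr => p' _.
  by rewrite coefZ mxE coef_hmul rowE poly_rV_K // fr // -ltnS.
have := generic_inj_kernel (@mult_kernel_polynomial F N r s' P Q B) M0.
apply: generic_imp => x injM W W0.
rewrite etaS_le ?addnS //.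
have := mult_kernel_semistable W injM; set w := \dim W; set d := \dim _ => le_wd.
have w_gt0 : (0 < w)%N by rewrite lt0n dimv_eq0.
have Q_gt0 : (0 < #|Q|)%N.
  by have : (0 < #|P| * w)%N by [rewrite muln_gt0 P0]; move/leq_trans/(_ le_wd); rewrite muln_gt0 => /andP[].
(* With [t = r + s'.+1], the chain is [#|Q| w t <= w #|P| s'.+1 <= #|Q| d s'.+1], and [#|Q|]
   cancels. *)
rewrite -(leq_pmul2l Q_gt0) mulnA [(#|Q| * w)%N]mulnC -mulnA -addnS.
apply: leq_trans (_ : w * (#|P| * s'.+1) <= _)%N; first by rewrite leq_mul2l cardPQ orbT.
by rewrite !mulnA leq_mul2r [(w * _)%N]mulnC le_wd orbT.
Qed.

(** * Failure of the inequality for every [V] when [d >= 2] *)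

Lemma rowsp_lincomb (F : fieldType) k n (A : 'M[F]_(k, n)) f :
  f \in rowsp A -> exists c : 'I_k -> F, f = \sum_i c i *: row i A.
Proof.
rewrite /rowsp span_def big_map big_enum => /memv_sumP[v vA ->].
have [c cE] := fin_all_exists (fun i => elimT (vlineP _ _) (vA i isT)).
by exists c; apply: eq_bigr.
Qed.

Lemma full_kernel (F : fieldType) n (M : 'M[F]_n.+1) lam :
  \dim (lker (linfun (mulmxr (M - lam%:M) : 'rV_n.+1 -> 'rV_n.+1))) = n.+1 -> M = lam%:M.
Proof.
set f := linfun _ => dimK.
have kerT : lker f = fullv.
  by apply/eqP; rewrite eqEdim subvf dimK dimvf /dim /= mul1n.
apply/eqP; rewrite -subr_eq0; apply/eqP/row_matrixP => j; rewrite row0 rowE.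
have : delta_mx 0 j \in lker f by rewrite kerT memvf.
by rewrite memv_ker lfunE => /eqP.
Qed.

(** The two inequalities add up to [s t <= t s], so neither is strict. *)
Lemma additive_slope k1 k2 l1 l2 s t :
  (k1 * t <= l1 * s -> k2 * t <= l2 * s -> k1 + k2 = s -> l1 + l2 = t -> k1 * t = l1 * s)%N.
Proof.
move=> + + sE tE; rewrite -sE -tE !mulnDr.
by rewrite (mulnC l1 k1) (mulnC k2 l1) (mulnC l2 k1) (mulnC k2 l2); lia.
Qed.

Section Unstable.
Variable F : closedFieldType.
Variables (N r s' : nat) (A : 'M[F]_(N.+1, r.+1)).
Let V := rowsp A.

Definition mult_mx (i : 'I_N.+1) : 'M[F]_(s'.+1, (r + s').+1) :=
  \matrix_b hmul (row i A) (delta_mx 0 b).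

Lemma mul_mult_mx i (w : 'rV_s'.+1) : w *m mult_mx i = hmul (row i A) w.
Proof.
rewrite mulmx_sum_row {2}[w]row_sum_delta hmul_sumr; apply: eq_bigr => b _.
by rewrite rowK.
Qed.

(** With [s = s'.+1] and [t = r + s], there are [s^2 + t^2] unknowns and [(N+1) s t + 1] equations.
    As [t - s = r], the difference is [d - 1 > 0]. *)
Lemma intertwiner_exists :
  (N.-1 * (s'.+1 * (r + s'.+1)) + 2 <= r ^ 2)%N -> (0 < N)%N ->
  exists (al : 'M[F]_s'.+1) (be : 'M[F]_((r + s').+1)),
    [/\ forall i, al *m mult_mx i = mult_mx i *m be, al 0 0 = 0
      & (al != 0) || (be != 0)].
Proof.
move=> q_ge2 N_gt0.
(* The extra equation, indexed by None, says al 0 0 = 0 and so excludes scalar pairs. *)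
pose K (a : ('I_s'.+1 * 'I_s'.+1) + ('I_(r + s').+1 * 'I_(r + s').+1))
    (c : option ('I_N.+1 * ('I_s'.+1 * 'I_(r + s').+1))) : F :=
  match a, c with
  | inl jk, None => ((jk.1 == 0) && (jk.2 == 0))%:R
  | inr _, None => 0
  | inl jk, Some (i, (b, c)) => (jk.1 == b)%:R * mult_mx i jk.2 c
  | inr jk, Some (i, (b, c)) => - (mult_mx i b jk.1 * (jk.2 == c)%:R)
  end.
have [|u [[a ua] uK]] := @kernel_nonzero _ _ _ K.
  rewrite card_sum card_option !card_prod !card_ord.
  by move: q_ge2; rewrite -mulnn; case: N N_gt0 => // n _ /=; nia.
exists (\matrix_(j, k) u (inl (j, k))), (\matrix_(j, k) u (inr (j, k))); split.
- move=> i; apply/matrixP => b c; apply/eqP; rewrite -subr_eq0 -[X in _ == X](uK (Some (i, (b, c)))).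
  rewrite big_sumType /= !mxE -sumrN; apply/eqP; congr (_ + _).
  + transitivity (\sum_j \sum_k u (inl (j, k)) * ((j == b)%:R * mult_mx i k c)); last first.
      by rewrite pair_bigA; apply: eq_bigr => -[].
    rewrite [RHS](bigD1 b) //= [X in _ + X]big1 ?addr0 => [|j /negPf nj]; last first.
      by rewrite big1 // => k _; rewrite nj mul0r mulr0.
    by apply: eq_bigr => k _; rewrite eqxx mul1r mxE.
  + transitivity (\sum_j \sum_k u (inr (j, k)) * - (mult_mx i b j * (k == c)%:R)); last first.
      by rewrite pair_bigA; apply: eq_bigr => -[].
    apply: eq_bigr => j _.
    rewrite [RHS](bigD1 c) //= [X in _ + X]big1 ?addr0 => [|k /negPf nk]; last first.
      by rewrite nk mulr0 oppr0 mulr0.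
    by rewrite eqxx mulr1 mulrN mulrC; congr (- (_ * _)); rewrite mxE.
- rewrite mxE; have := uK None; rewrite big_sumType /= [X in _ + X]big1 ?addr0 => [|? _]; last exact: mulr0.
  rewrite (bigD1 (0, 0)) //= ?eqxx mulr1 big1 ?addr0 // => -[j k]; rewrite xpair_eqE => /negPf ->.
  by rewrite mulr0.
- apply: contraR ua; rewrite negb_or !negbK => /andP[/eqP al0 /eqP be0].
  case: a => -[j k].
  + by have := congr1 (fun M : 'M_s'.+1 => M j k) al0; rewrite !mxE => ->.
  + by have := congr1 (fun M : 'M_((r + s').+1) => M j k) be0; rewrite !mxE => ->.
Qed.

Lemma unstable : (0 < N)%N -> coprime r s'.+1 ->
  (N.-1 * (s'.+1 * (r + s'.+1)) + 2 <= r ^ 2)%N ->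
  ~ (forall W : {vspace 'rV[F]_s'.+1}, W != 0%VS ->
      etaS s'.+1 W <= etaS (r + s'.+1) (prodS V W)).
Proof.
move=> N_gt0 cop_rs q_ge2 stable.
have [al [be [alM al00 nz]]] := intertwiner_exists q_ge2 N_gt0.
have [lam /eigenvalueP[v0 v0al v0_neq0]] : exists a, eigenvalue al a.
  have /closed_rootP[a] : size (char_poly al) != 1 by rewrite size_char_poly.
  by rewrite -eigenvalue_root_char => ?; exists a.
pose fa := linfun (mulmxr (al - lam%:M) : 'rV_s'.+1 -> 'rV_s'.+1).
pose fb := linfun (mulmxr (be - lam%:M) : 'rV_((r + s').+1) -> 'rV_((r + s').+1)).
have fab f w : f \in V -> hmul f (fa w) = fb (hmul f w).
  move=> /rowsp_lincomb[c ->]; rewrite !hmul_suml linear_sum; apply: eq_bigr => i _ /=.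
  rewrite linearZ /= !lfunE /=; congr (_ *: _).
  rewrite -!mul_mult_mx -!mulmxA; congr (_ *m _).
  by rewrite mulmxBl mulmxBr alM mul_scalar_mx mul_mx_scalar.
have stable_nat (W : {vspace 'rV[F]_s'.+1}) : (\dim W * (r + s'.+1) <= \dim (prodS V W) * s'.+1)%N.
  have [->|W0] := eqVneq W 0%VS; first by rewrite dimv0.
  by rewrite -etaS_le ?addnS //; have := stable W W0; rewrite addnS.
have kerS : (prodS V (lker fa) <= lker fb)%VS.
  apply: prodS_sub => f w Vf; rewrite !memv_ker -fab // => /eqP ->.
  by rewrite /hmul linear0 mulr0 linear0.
have imgS : (prodS V (limg fa) <= limg fb)%VS.
  by apply: prodS_sub => f _ Vf /memv_imgP[w _ ->]; rewrite fab // memv_img ?memvf.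
have dimS := limg_ker_dim fa fullv; have dimT := limg_ker_dim fb fullv.
rewrite !capfv !dimvf /dim /= !mul1n in dimS dimT.
have k_gt0 : (0 < \dim (lker fa))%N.
  rewrite lt0n dimv_eq0; apply: contraNneq v0_neq0 => ker0.
  rewrite -memv0 -ker0 memv_ker lfunE /= mulmxBr v0al mul_mx_scalar subrr //.
have leK := leq_trans (stable_nat (lker fa)) (leq_mul (dimvS kerS) (leqnn s'.+1)).
have leI := leq_trans (stable_nat (limg fa)) (leq_mul (dimvS imgS) (leqnn s'.+1)).
have eqK : (\dim (lker fa) * (r + s'.+1) = \dim (lker fb) * s'.+1)%N.
  by apply: (additive_slope leK leI dimS); rewrite dimT addnS.
(* By [eqK] and coprimality [s'.+1] divides the dimension of the kernel, which is positive: the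
   kernel is everything. *)
have dimK : \dim (lker fa) = s'.+1.
  have dvd : (s'.+1 %| \dim (lker fa))%N.
    rewrite -(@Gauss_dvdl _ _ (r + s'.+1)); first by rewrite eqK dvdn_mull.
    by rewrite /coprime gcdnDr gcdnC.
  by apply/eqP; rewrite eqn_leq (dvdn_leq k_gt0 dvd) andbT; apply: leq_trans (leq_addr _ _) (eq_leq dimS).
have dimL : \dim (lker fb) = (r + s').+1.
  by move: eqK; rewrite dimK mulnC => /eqP; rewrite eqn_pmul2r // addnS => /eqP.
(* Both matrices are now the scalar [lam], and the normalization [al 0 0 = 0] makes them vanish. *)
move: nz al00; rewrite (full_kernel dimK) (full_kernel dimL) mxE eqxx mulr1n => nz lam0.
by rewrite lam0 !raddf0 !eqxx in nz.
Qed.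

End Unstable.

(** * The map [rho], its fixed point and the set [Phi] *)

Section RealPart.
Variable N : nat.
Hypothesis N_gt1 : (1 < N)%N.
Import Reals Lra ssrnat.
Local Open Scope R_scope.

Let M := INR N - 1.

Lemma M_ge1 : 1 <= M.
Proof. by have := le_INR _ _ (elimT ssrnat.leP N_gt1); rewrite /M /=; lra. Qed.

(** The positive root of [M (x^2 + x) = 1], which is the limit [phi_N]. *)
Definition fixed_rho := (sqrt (M * M + 4 * M) - M) / (2 * M).

Lemma fixed_rho_pos : 0 < fixed_rho.
Proof.
have M1 := M_ge1; apply: Rdiv_lt_0_compat; last lra.
have : sqrt (M * M) < sqrt (M * M + 4 * M) by apply: sqrt_lt_1; nra.
by rewrite sqrt_square; lra.
Qed.

Lemma fixed_rhoE : M * (fixed_rho * fixed_rho + fixed_rho) = 1.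
Proof.
have M1 := M_ge1; have sE : sqrt (M * M + 4 * M) * sqrt (M * M + 4 * M) = M * M + 4 * M.
  by apply: sqrt_sqrt; nra.
rewrite /fixed_rho; set q := sqrt _ in sE *.
transitivity ((q * q - M * M) / (4 * M)); first by field; lra.
by rewrite sE; field; lra.
Qed.

Lemma rhoE x : 0 <= x -> rho N x = (1 + x) / (M * (1 + x) + 1).
Proof.
move=> x0; have M1 := M_ge1; rewrite /rho -/M; field; split; nra.
Qed.

Lemma rho_ge0 x : 0 <= x -> 0 <= rho N x <= 1.
Proof.
move=> x0; have M1 := M_ge1; rewrite rhoE //; split.
  by apply: Rlt_le; apply: Rdiv_lt_0_compat; nra.
apply: (Rmult_le_reg_r (M * (1 + x) + 1)); first by nra.
by rewrite /Rdiv Rmult_assoc Rinv_l; nra.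
Qed.

Lemma rho_fixed : rho N fixed_rho = fixed_rho.
Proof.
have M1 := M_ge1; have p0 := fixed_rho_pos; have pE := fixed_rhoE.
rewrite rhoE; last lra.
apply: (Rmult_eq_reg_r (M * (1 + fixed_rho) + 1)); last by nra.
by rewrite /Rdiv Rmult_assoc Rinv_l; nra.
Qed.

Lemma rho_contract x : 0 <= x ->
  Rabs (rho N x - fixed_rho) <= / (1 + fixed_rho) * Rabs (x - fixed_rho).
Proof.
move=> x0; have M1 := M_ge1; have p0 := fixed_rho_pos; have pE := fixed_rhoE.
have pfix := rho_fixed; set p := fixed_rho in p0 pE pfix *.
(* From [rho x - rho p = (x - p) / ((M (1+x) + 1) (M (1+p) + 1))], where the fixed point equation
   turns [1 / (M (1+p) + 1)] into [p / (1+p)]. *)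
have -> : rho N x - p = (x - p) * ((p / (1 + p)) / (M * (1 + x) + 1)).
  rewrite -{1}pfix !rhoE //; last lra.
  have -> : p / (1 + p) = / (M * (1 + p) + 1).
    apply: (Rmult_eq_reg_r (M * (1 + p) + 1)); last by nra.
    rewrite Rinv_l; last by nra.
    apply: (Rmult_eq_reg_r (1 + p)); last by lra.
    by field_simplify; nra.
  by field; split; nra.
rewrite Rabs_mult Rmult_comm; apply: Rmult_le_compat_r; first exact: Rabs_pos.
have q0 : 0 < p / (1 + p) / (M * (1 + x) + 1).
  by apply: Rdiv_lt_0_compat; [apply: Rdiv_lt_0_compat|]; nra.
rewrite Rabs_pos_eq; last exact: Rlt_le.
rewrite /Rdiv (Rmult_comm p) Rmult_assoc -[X in _ <= X]Rmult_1_r.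
apply: Rmult_le_compat_l; first by apply: Rlt_le; apply: Rinv_0_lt_compat; lra.
apply: (Rmult_le_reg_r (M * (1 + x) + 1)); first by nra.
by rewrite Rmult_assoc Rinv_l; nra.
Qed.

Lemma rho_iter_ge0 i : 0 <= rho_iter N i.
Proof.
case: i => [|i]; first by rewrite /rho_iter /=; lra.
suff : 0 <= rho_iter N i by move=> /rho_ge0[].
by elim: i => [|i IHi]; [rewrite /rho_iter /=; lra | have [] := rho_ge0 IHi].
Qed.

Lemma rho_iter_cv : Un_cv (rho_iter N) fixed_rho.
Proof.
have p0 := fixed_rho_pos.
have k_lt1 : Rabs (/ (1 + fixed_rho)) < 1.
  rewrite Rabs_pos_eq; last by apply: Rlt_le; apply: Rinv_0_lt_compat; lra.
  by rewrite -Rinv_1; apply: Rinv_lt_contravar; lra.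
have bound i : Rabs (rho_iter N i - fixed_rho) <= (/ (1 + fixed_rho)) ^ i * fixed_rho.
  elim: i => [|i IHi]; first by rewrite /rho_iter /= Rabs_minus_sym Rabs_pos_eq; lra.
  apply: Rle_trans (rho_contract (rho_iter_ge0 i)) _; rewrite /= Rmult_assoc.
  by apply: Rmult_le_compat_l => //; apply: Rlt_le; apply: Rinv_0_lt_compat; lra.
move=> eps eps0; have [n nP] := pow_lt_1_zero _ k_lt1 (eps / fixed_rho) (Rdiv_lt_0_compat _ _ eps0 p0).
exists n => i /nP lt_i; rewrite /R_dist; apply: Rle_lt_trans (bound i) _.
rewrite Rabs_pos_eq in lt_i; last by apply: pow_le; apply: Rlt_le; apply: Rinv_0_lt_compat; lra.
apply: (Rmult_lt_reg_r (/ fixed_rho)); first exact: Rinv_0_lt_compat.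
by rewrite Rmult_assoc Rinv_r; lra.
Qed.

Lemma gt_fixed_rho x : 0 < x -> (fixed_rho < x <-> 1 < M * (x * x + x)).
Proof.
move=> x0; have M1 := M_ge1; have p0 := fixed_rho_pos; have pE := fixed_rhoE.
by split=> h; nra.
Qed.

Lemma fixed_rho_lt (r s : nat) : (0 < r)%N -> (0 < s)%N ->
  (fixed_rho < ratioR s r <-> (r ^ 2 < N.-1 * (s * (r + s)))%N).
Proof.
move=> r_gt0 s_gt0; have M1 := M_ge1.
have a0 := lt_0_INR s (elimT ssrnat.ltP s_gt0); have b0 := lt_0_INR r (elimT ssrnat.ltP r_gt0).
have ME : INR N.-1 = M by rewrite /M -{2}(prednK (ltnW N_gt1)) S_INR; lra.
rewrite gt_fixed_rho; last exact: Rdiv_lt_0_compat.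
have -> : M * (ratioR s r * ratioR s r + ratioR s r) =
    INR (N.-1 * (s * (r + s)))%N / INR (r ^ 2)%N.
  by rewrite -mulnn !mult_INR plus_INR ME /ratioR; field; lra.
have r20 : 0 < INR (r ^ 2)%N by rewrite -mulnn mult_INR; nra.
split=> [lt1|/ssrnat.ltP/lt_INR lt_q].
  apply/ssrnat.ltP; apply: INR_lt.
  have := Rmult_lt_compat_r _ _ _ r20 lt1.
  by rewrite /Rdiv Rmult_assoc Rinv_l; lra.
apply: (Rmult_lt_reg_r _ _ _ r20).
by rewrite /Rdiv Rmult_assoc Rinv_l; lra.
Qed.

Lemma ratioR_reflect (r s : nat) : (0 < r)%N ->
  ratioR (r + s)%N (N * r + N.-1 * s)%N = rho N (ratioR s r).
Proof.
move=> r_gt0; have M1 := M_ge1.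
have b0 := lt_0_INR r (elimT ssrnat.ltP r_gt0); have a0 := pos_INR s.
have ME : INR N.-1 = M by rewrite /M -{2}(prednK (ltnW N_gt1)) S_INR; lra.
have NE : INR N = M + 1 by rewrite /M; lra.
rewrite rhoE; last by apply: Rmult_le_pos => //; apply: Rlt_le; apply: Rinv_0_lt_compat.
by rewrite /ratioR !plus_INR !mult_INR ME NE; field; split; nra.
Qed.

(** Start from the pair [(1, 0)] and reflect: [rho] acts on the ratio and [d = 1] persists. *)
Lemma rho_iter_ratio i : exists r s : nat,
  [/\ (0 < r)%N, rho_iter N i = ratioR s r & (r ^ 2 = N.-1 * (s * (r + s)) + 1)%N].
Proof.
elim: i => [|i [r [s [r0 iE q1]]]].
  by exists 1%N, 0%N; split=> //; rewrite /ratioR /rho_iter /= ?muln0 //; field.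
exists (N * r + N.-1 * s)%N, (r + s)%N; split.
- by rewrite addn_gt0 muln_gt0 r0 ltnW.
- by rewrite ratioR_reflect // -iE.
- by case: N N_gt1 q1 => // n _; apply: reflect_real_root.
Qed.

Lemma ratio_rho_iter (r s : nat) : (0 < r)%N -> (r ^ 2 = N.-1 * (s * (r + s)) + 1)%N ->
  exists i, ratioR s r = rho_iter N i.
Proof.
have [n] := ubnP (r + s); elim: n r s => // n IHn r s le_n r_gt0 q1.
have [s0|s_gt0] := posnP s.
  exists 0%N; rewrite s0 /ratioR /rho_iter /=.
  have b0 := lt_0_INR r (elimT ssrnat.ltP r_gt0); by field; lra.
have lt_r : (N.-1 * s < r)%N.
  by rewrite ltnNge; apply/negP => le_r; move: q1; rewrite -mulnn; nia.
have [r1 [s1 [r1_gt0 sE rE qE]]] := reflection_descent (ltnW N_gt1) lt_r (eq_leq q1) s_gt0.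
have [|||i iE] := IHn r1 s1 => //.
- by rewrite sE; lia.
- by rewrite sE; lia.
by exists i.+1; rewrite rE -sE ratioR_reflect // iE.
Qed.

Lemma in_PhiP (r s : nat) : (0 < r)%N -> (0 < s)%N -> coprime r s ->
  (in_Phi N (ratioR s r) <-> (r ^ 2 <= N.-1 * (s * (r + s)) + 1)%N).
Proof.
move=> r_gt0 s_gt0 cop; split.
  case=> [[phi [phi_cv lt_phi]]|[i iE]].
    have phiE := UL_sequence _ _ _ phi_cv rho_iter_cv.
    by rewrite phiE in lt_phi; move/(fixed_rho_lt r_gt0 s_gt0): lt_phi; lia.
  (* [(R, T)] need not be [(r, s)], but [r] and [s] are coprime, so [r] divides [R]. *)
  have [R [T [R_gt0 RE q1]]] := rho_iter_ratio i.
  have cross : (s * R = T * r)%N.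
    apply: INR_eq; rewrite !mult_INR.
    have b0 := lt_0_INR r (elimT ssrnat.ltP r_gt0); have B0 := lt_0_INR R (elimT ssrnat.ltP R_gt0).
    have eq : INR s / INR r = INR T / INR R by rewrite -/(ratioR s r) iE RE.
    have := f_equal (fun x => x * (INR r * INR R)) eq; rewrite /=.
    have -> : INR s / INR r * (INR r * INR R) = INR s * INR R by field; lra.
    by have -> : INR T / INR R * (INR r * INR R) = INR T * INR r by field; lra.
  have le_rR : (r <= R)%N.
    by apply: dvdn_leq => //; rewrite -(Gauss_dvdr _ cop) cross dvdn_mull.
  exact: proportional_root R_gt0 le_rR cross q1.
rewrite leq_eqVlt addn1 ltnS leq_eqVlt => /orP[/eqP q1|/orP[/eqP q0|lt_q]].
- by right; apply: ratio_rho_iter => //; rewrite addn1.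
(* The case [d = 0] is impossible: [s] divides [r^2], so [s = 1]; then [r + 1] divides [r^2], to
   which it is coprime. *)
- have s1 : s = 1%N.
    have : (s %| r ^ 2)%N by rewrite q0 mulnCA dvdn_mulr.
    by rewrite -[(r ^ 2)%N]muln1 Gauss_dvdr ?coprimeXr 1?coprime_sym // dvdn1 => /eqP.
  have : (r + 1 %| r ^ 2)%N by rewrite q0 s1 mul1n dvdn_mull.
  rewrite -[(r ^ 2)%N]muln1 Gauss_dvdr ?dvdn1; first by rewrite addn1 eqSS => /eqP r0; rewrite r0 in r_gt0.
  by rewrite coprimeXr // addn1 coprime_sym coprimenS.
- left; exists fixed_rho; split; first exact: rho_iter_cv.
  exact/fixed_rho_lt.
Qed.

End RealPart.

(* The equivalence for a general [V] *)
Local Close Scope ring_scope.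

Theorem theorem1p2 (F : numClosedFieldType) (N r s : nat) :
  (2 <= N)%N -> (0 < r)%N -> (0 < s)%N -> coprime r s -> (N <= r)%N ->
  general_subspace N.+1
    (fun V : {vspace 'rV[F]_r.+1} =>
       (forall W : {vspace 'rV[F]_(s.-1).+1}, W != 0%VS ->
          (etaS s W <= etaS (r + s) (prodS V W))%R)
       <-> in_Phi N (ratioR s r)).
Proof.
move=> N_gt1 r_gt0 s_gt0 cop le_Nr.
apply: generic_general => //; have PhiE := in_PhiP N_gt1 r_gt0 s_gt0 cop.
case: s s_gt0 cop PhiE => // s' s_gt0 cop PhiE.
have [q_le1|q_ge2] := leqP (r ^ 2) (N.-1 * (s'.+1 * (r + s'.+1)) + 1).
  have := balanced_generic (balanced_exists F N_gt1 r_gt0 q_le1).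
  by apply: generic_imp => x stable; split=> // _; apply/PhiE.
(* For [d >= 2] both sides are false for every [V], so the matrices of full rank serve as the open
   set. *)
have := full_rank_generic F (le_Nr : N.+1 <= r.+1).
apply: generic_imp => x _; split=> [stable|/PhiE]; last by rewrite leqNgt q_ge2.
case: (unstable (ltnW N_gt1) cop _ stable).
by rewrite addn2 -addn1.
Qed.
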